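(* Let $Q\succ 0$, $R\succ 0$, $\lambda_1=0$, let $\mathcal U\subseteq\mathbb R^m$ and $\mathcal Y\subseteq\mathbb R^p$ be convex, and suppose that $H_1=\mathrm{col}(U_{\rm P},Y_{\rm P},U_{\rm F})$ has full row rank. Then for every $\lambda_y>0$ the problems (Data-Driven-SPC) and (SPC) given in the context have the same optimal solution $(u^*,y^*,\sigma_y^* )$; that is, a triple $(u,y,\sigma_y)$ is the $(u,y,\sigma_y)$-part of an optimal solution $(g,u,y,\sigma_y)$ of (Data-Driven-SPC) if and only if it is an optimal solution of (SPC).
   Context: Notation: $\mathrm{col}(A_1,\dots,A_k)=[A_1^{\mathsf T},\dots,A_k^{\mathsf T}]^{\mathsf T}$; $A^\dagger$ is the Moore–Penrose pseudoinverse. Data. Let $m,p,T_{\rm ini},N,T$ be positive integers, $L=T_{\rm ini}+N\le T$. Let $u_{\rm d}=\mathrm{col}(u_{\rm d}(1),\dots,u_{\rm d}(T))$ with $u_{\rm d}(i)\in\mathbb R^m$ and $y_{\rm d}=\mathrm{col}(y_{\rm d}(1),\dots,y_{\rm d}(T))$ with $y_{\rm d}(i)\in\mathbb R^p$ be the pre-collected (possibly noisy) input/output data. For a sequence $\omega$ of length $T$, $\mathcal H_L(\omega)$ is the Hankel matrix with $L$ block rows and $T-L+1$ columns whose $(i,j)$ block is $\omega(i+j-1)$. Partition $\mathcal H_L(u_{\rm d})=\mathrm{col}(U_{\rm P},U_{\rm F})$ and $\mathcal H_L(y_{\rm d})=\mathrm{col}(Y_{\rm P},Y_{\rm F})$,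 where the subscript P denotes the first $T_{\rm ini}$ block rows and F the last $N$ block rows. Put $H_1=\mathrm{col}(U_{\rm P},Y_{\rm P},U_{\rm F})$, $\Pi_1=H_1^\dagger H_1$ and $M=Y_{\rm F}\Pi_1$. Let $u_{\rm ini}\in\mathbb R^{mT_{\rm ini}}$, $y_{\rm ini}\in\mathbb R^{pT_{\rm ini}}$ be given (the most recent past inputs and outputs). The decision variables are $g\in\mathbb R^{T-L+1}$, $\sigma_y\in\mathbb R^{pT_{\rm ini}}$, $u=\mathrm{col}(u(t),\dots,u(t+N-1))\in\mathbb R^{mN}$, $y=\mathrm{col}(y(t),\dots,y(t+N-1))\in\mathbb R^{pN}$. For symmetric $R\in\mathbb R^{m\times m}$ and $Q\in\mathbb R^{p\times p}$, $\|u\|_R^2=\sum_{k=t}^{t+N-1}u(k)^{\mathsf T}Ru(k)$ and $\|y\|_Q^2=\sum_{k=t}^{t+N-1}y(k)^{\mathsf T}Qy(k)$. The constraints ''$u\in\mathcal U$, $y\in\mathcal Y$'' mean $u(k)\in\mathcal U$ and $y(k)\in\mathcal Y$ for all $k\in\{t,\dots,t+N-1\}$. (Data-Driven-SPC): minimize over $(g,\sigma_y,u,y)$ with $u\in\mathcal U$, $y\in\mathcal Y$ the cost $\|u\|_R^2+\|y\|_Q^2+\lambda_1\|g\|_1+\lambda_y\|\sigma_y\|_2^2$ subject to $\mathrm{col}(U_{\rm P},Y_{\rm P},U_{\rm F},M)\,g=\mathrm{col}(u_{\rm ini},\,y_{\rm ini}+\sigma_y,\,u,\,y)$. (SPC):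 minimize over $(\sigma_y,u,y)$ with $u\in\mathcal U$, $y\in\mathcal Y$ the cost $\|u\|_R^2+\|y\|_Q^2+\lambda_y\|\sigma_y\|_2^2$ subject to $y=Y_{\rm F}H_1^\dagger\,\mathrm{col}(u_{\rm ini},\,y_{\rm ini}+\sigma_y,\,u)$. *)

(* Defs.v *)
From HB Require Import structures.
From mathcomp Require Import all_boot all_order all_algebra.
From mathcomp Require Import boolp classical_sets reals convex.
Set Implicit Arguments.
Unset Strict Implicit.
Unset Printing Implicit Defensive.
Import Order.TTheory GRing.Theory Num.Theory.
Local Open Scope classical_set_scope.
Local Open Scope ring_scope.

Definition penrose (K : realType) (m n : nat) (A : 'M[K]_(m, n))
    (X : 'M[K]_(n, m)) : Prop :=
  [/\ A *m X *m A = A, X *m A *m X = X,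
      (A *m X)^T = A *m X & (X *m A)^T = X *m A].

(* Not MathComp's [pinvmx], which is only a partial inverse on the row space and
   need not satisfy the two symmetry conditions. The default value 0 is never
   used: see [mpinvP]. *)
Definition mpinv (K : realType) (m n : nat) (A : 'M[K]_(m, n)) :
    'M[K]_(n, m) :=
  xget 0 [set X | penrose A X].

Lemma gram_unitmx (K : realType) (m n : nat) (B : 'M[K]_(m, n)) :
  row_free B -> B *m B^T \in unitmx.
Proof.
move=> fB; rewrite -row_free_unit -kermx_eq0.
apply/eqP/row_matrixP => i; rewrite row0.
set v := row i _.
have v0 : v *m (B *m B^T) = 0 by rewrite -row_mul mulmx_ker row0.
have : (v *m B) *m (v *m B)^T = 0.
  by rewrite trmx_mul mulmxA -(mulmxA v) v0 mul0mx.
move=> /matrixP /(_ 0 0); rewrite !mxE => /eqP.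
rewrite psumr_eq0; last by move=> j _; rewrite [_^T _ _]mxE -expr2 sqr_ge0.
move=> /allP z; apply: (row_free_inj fB); rewrite mul0mx.
apply/matrixP => a j; rewrite (ord1 a) [RHS]mxE.
have := z j (mem_index_enum _); rewrite [_^T _ _]mxE mulf_eq0 orbb.
by move=> /eqP.
Qed.

Lemma penrose_factor (K : realType) (m n r : nat) (C : 'M[K]_(m, r))
    (B : 'M[K]_(r, n)) :
  row_free C^T -> row_free B -> exists X, penrose (C *m B) X.
Proof.
move=> fC fB.
have uB : B *m B^T \in unitmx by apply: gram_unitmx.
have uC : C^T *m C \in unitmx by rewrite -{2}[C]trmxK; apply: gram_unitmx.
pose G := invmx (B *m B^T); pose H := invmx (C^T *m C).
have BG : B *m B^T *m G = 1%:M by rewrite mulmxV.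
have HC : H *m C^T *m C = 1%:M by rewrite -mulmxA mulVmx.
have GT : G^T = G by rewrite trmx_inv trmx_mul trmxK.
have HT : H^T = H by rewrite trmx_inv trmx_mul trmxK.
pose X := B^T *m G *m (H *m C^T).
have AX : C *m B *m X = C *m (H *m C^T).
  by rewrite /X !mulmxA -2!(mulmxA C) BG mulmx1.
have XA : X *m (C *m B) = B^T *m G *m B.
  by rewrite /X !mulmxA -2!(mulmxA (B^T *m G)) HC mulmx1.
exists X; split.
- by rewrite AX -!mulmxA (mulmxA C^T) (mulmxA H) (mulmxA H) HC mul1mx.
- by rewrite XA /X mulmxA -!mulmxA (mulmxA B) (mulmxA (B *m _)) BG mul1mx.
- by rewrite AX !trmx_mul trmxK HT -mulmxA.
- by rewrite XA !trmx_mul trmxK GT mulmxA.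
Qed.

Lemma penrose_exists (K : realType) (m n : nat) (A : 'M[K]_(m, n)) :
  exists X, penrose A X.
Proof.
have fC : row_free (col_base A)^T.
  by have := col_base_full A; rewrite /row_free mxrank_tr.
by have := penrose_factor fC (row_base_free A); rewrite mulmx_base.
Qed.

Lemma penrose_unique (K : realType) (m n : nat) (A : 'M[K]_(m, n)) X Y :
  penrose A X -> penrose A Y -> X = Y.
Proof.
move=> [x1 x2 x3 x4] [y1 y2 y3 y4].
have e1 : A *m X = A *m Y.
  by rewrite -x3 -{1}y1 -mulmxA trmx_mul x3 y3 mulmxA x1.
have e2 : X *m A = Y *m A.
  by rewrite -x4 -{1}y1 -mulmxA mulmxA trmx_mul x4 y4 -mulmxA (mulmxA A) x1.
by rewrite -x2 e2 -mulmxA e1 mulmxA y2.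
Qed.

Lemma mpinvP (K : realType) (m n : nat) (A : 'M[K]_(m, n)) :
  penrose A (mpinv A).
Proof. by have [X PX] := penrose_exists A; apply: (xgetPex 0); exists X. Qed.

(* Blocks are indexed from 0, so block [k]
    of a trajectory starting at time [t] is its value at time [t + k]. *)
Notation blkcV K n q := 'cV[K]_(\sum_(i < n) q)%N.

Definition blk (K : realType) (n q : nat) (w : blkcV K n q) (k : 'I_n) :
    'cV[K]_q :=
  @submxcol K n (fun=> q) 1 w k.

Lemma hankel_ltn (T L : nat) (LT : (L <= T)%N) (i : 'I_L)
    (j : 'I_(T - L).+1) : (i + j < T)%N.
Proof.
have jT : (j <= T - L)%N by rewrite -ltnS.
by have := leq_add (ltn_ord i) jT; rewrite addSn subnKC.
Qed.

Definition hankel (K : realType) (T L q : nat) (LT : (L <= T)%N)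
    (w : blkcV K T q) : 'M[K]_(\sum_(i < L) q, (T - L).+1) :=
  \mxcol_(i < L) \matrix_(a < q, j < (T - L).+1)
    blk w (Ordinal (hankel_ltn LT i j)) a 0.

Definition past_rows (K : realType) (Tini N q n : nat)
    (H : 'M[K]_(\sum_(i < Tini + N) q, n)) : 'M[K]_(\sum_(i < Tini) q, n) :=
  \mxcol_(i < Tini) @submxcol K (Tini + N) (fun=> q) n H (lshift N i).

Definition future_rows (K : realType) (Tini N q n : nat)
    (H : 'M[K]_(\sum_(i < Tini + N) q, n)) : 'M[K]_(\sum_(i < N) q, n) :=
  \mxcol_(i < N) @submxcol K (Tini + N) (fun=> q) n H (rshift Tini i).

Definition posdefmx (K : realType) (n : nat) (S : 'M[K]_n) : Prop :=
  S^T = S /\ forall x : 'cV[K]_n, x != 0 -> 0 < (x^T *m S *m x) 0 0.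

Definition wnorm2 (K : realType) (n q : nat) (S : 'M[K]_q)
    (w : blkcV K n q) : K :=
  \sum_(k < n) ((blk w k)^T *m S *m blk w k) 0 0.

Definition norm1 (K : realType) (n : nat) (g : 'cV[K]_n) : K :=
  \sum_(i < n) `|g i 0|.

Definition norm2sq (K : realType) (n : nat) (s : 'cV[K]_n) : K :=
  \sum_(i < n) s i 0 ^+ 2.

Definition optimal (K : realType) (X : Type) (feasible : set X)
    (cost : X -> K) (x : X) : Prop :=
  feasible x /\ forall x', feasible x' -> cost x <= cost x'.

(* Decision variables are ordered [(g, sigma_y, u, y)] here and
   [(sigma_y, u, y)] in [spc_feasible]. *)

Definition dd_spc_feasible (K : realType) (m p Tini N n : nat)
    (UP : 'M[K]_(\sum_(i < Tini) m, n)) (YP : 'M[K]_(\sum_(i < Tini) p, n))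
    (UF : 'M[K]_(\sum_(i < N) m, n)) (YF : 'M[K]_(\sum_(i < N) p, n))
    (uini : blkcV K Tini m) (yini : blkcV K Tini p)
    (U : set 'cV[K]_m) (Y : set 'cV[K]_p) :
    set ('cV[K]_n * blkcV K Tini p * blkcV K N m * blkcV K N p) :=
  [set x | let: (g, sigma, u, y) := x in
    let H1 := col_mx UP (col_mx YP UF) in
    let Pi1 := mpinv H1 *m H1 in
    let M := YF *m Pi1 in
    [/\ forall k, U (blk u k), forall k, Y (blk y k) &
        col_mx UP (col_mx YP (col_mx UF M)) *m g =
        col_mx uini (col_mx (yini + sigma) (col_mx u y))]].

Definition dd_spc_cost (K : realType) (m p Tini N n : nat)
    (R : 'M[K]_m) (Q : 'M[K]_p) (lambda1 lambday : K)
    (x : 'cV[K]_n * blkcV K Tini p * blkcV K N m * blkcV K N p) : K :=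
  let: (g, sigma, u, y) := x in
  wnorm2 R u + wnorm2 Q y + lambda1 * norm1 g + lambday * norm2sq sigma.

Definition spc_feasible (K : realType) (m p Tini N n : nat)
    (UP : 'M[K]_(\sum_(i < Tini) m, n)) (YP : 'M[K]_(\sum_(i < Tini) p, n))
    (UF : 'M[K]_(\sum_(i < N) m, n)) (YF : 'M[K]_(\sum_(i < N) p, n))
    (uini : blkcV K Tini m) (yini : blkcV K Tini p)
    (U : set 'cV[K]_m) (Y : set 'cV[K]_p) :
    set (blkcV K Tini p * blkcV K N m * blkcV K N p) :=
  [set x | let: (sigma, u, y) := x in
    let H1 := col_mx UP (col_mx YP UF) in
    [/\ forall k, U (blk u k), forall k, Y (blk y k) &
        y = YF *m mpinv H1 *m col_mx uini (col_mx (yini + sigma) u)]].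

Definition spc_cost (K : realType) (m p Tini N : nat)
    (R : 'M[K]_m) (Q : 'M[K]_p) (lambday : K)
    (x : blkcV K Tini p * blkcV K N m * blkcV K N p) : K :=
  let: (sigma, u, y) := x in
  wnorm2 R u + wnorm2 Q y + lambday * norm2sq sigma.

(* Main.v *)
(* When [lambda1 = 0] neither cost depends on [g], and since [M *m g] only
   depends on [H1 *m g], eliminating [g] from the first problem leaves exactly
   the SPC predictor.  Full row rank makes the elimination lossless:
   [H1 *m mpinv H1 = 1] provides a [g] for every SPC-feasible triple. *)

Require Import Defs.
From mathcomp Require Import all_boot all_order all_algebra.
From mathcomp Require Import boolp classical_sets reals convex.
Import Order.TTheory GRing.Theory Num.Theory.
Local Open Scope classical_set_scope.
Local Open Scope ring_scope.

(** Right multiplication by a matrix with independent rows is injective, so [A] cancels on the right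
    of the first Penrose identity [A *m mpinv A *m A = A]. *)
Lemma mulmx_mpinv (K : realType) (m n : nat) (A : 'M[K]_(m, n)) :
  row_free A -> A *m mpinv A = 1%:M.
Proof.
move=> fA; apply: (row_free_inj fA); rewrite mul1mx.
by have [] := mpinvP A.
Qed.

Section Elimination.
Variables (K : realType) (m p Tini N n : nat).
Variables (UP : 'M[K]_(\sum_(i < Tini) m, n)) (YP : 'M[K]_(\sum_(i < Tini) p, n)).
Variables (UF : 'M[K]_(\sum_(i < N) m, n)) (YF : 'M[K]_(\sum_(i < N) p, n)).
Variables (uini : blkcV K Tini m) (yini : blkcV K Tini p).
Variables (U : set 'cV[K]_m) (Y : set 'cV[K]_p).

Let H1 := col_mx UP (col_mx YP UF).
Let dd_feasible := dd_spc_feasible UP YP UF YF uini yini U Y.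
Let feasible := spc_feasible UP YP UF YF uini yini U Y.

(** The first three block rows of the constraint prescribe [H1 *m g]. Since
    [M *m g = YF *m mpinv H1 *m (H1 *m g)], substituting that value turns the last block row into
    the SPC predictor equation. *)
Lemma dd_spc_feasibleE (g : 'cV[K]_n) (sigma : blkcV K Tini p)
    (u : blkcV K N m) (y : blkcV K N p) :
  dd_feasible (g, sigma, u, y) <->
  feasible (sigma, u, y) /\
  H1 *m g = col_mx uini (col_mx (yini + sigma) u).
Proof.
rewrite /dd_feasible /feasible /= !mul_col_mx; split.
- move=> [uU yY /eq_col_mx[eUP /eq_col_mx[eYP /eq_col_mx[eUF eM]]]].
  have eH1 : H1 *m g = col_mx uini (col_mx (yini + sigma) u).
    by rewrite !mul_col_mx eUP eYP eUF.
  by split; [split=> //; rewrite -eH1 -eM !mulmxA | rewrite -eH1 !mul_col_mx].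
- move=> [[uU yY ey] eH1]; split=> //.
  have [eUP /eq_col_mx[eYP eUF]] := eq_col_mx eH1.
  congr col_mx => //; congr col_mx => //; congr col_mx => //.
  by rewrite ey -eH1 -!mul_col_mx !mulmxA.
Qed.

Lemma dd_spc_feasible_ex (sigma : blkcV K Tini p) (u : blkcV K N m)
    (y : blkcV K N p) :
  row_free H1 ->
  (exists g, dd_feasible (g, sigma, u, y)) <-> feasible (sigma, u, y).
Proof.
move=> fH1; split=> [[g /dd_spc_feasibleE[]]//|fea].
(* The least-norm candidate for [H1 *m g = b]; full row rank makes it a solution for every
   right-hand side [b]. *)
exists (mpinv H1 *m col_mx uini (col_mx (yini + sigma) u)).
by apply/dd_spc_feasibleE; rewrite mulmxA mulmx_mpinv // mul1mx.
Qed.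

End Elimination.

Lemma dd_spc_cost0 (K : realType) (m p Tini N n : nat) (R : 'M[K]_m)
    (Q : 'M[K]_p) (lambday : K) (g : 'cV[K]_n) (sigma : blkcV K Tini p)
    (u : blkcV K N m) (y : blkcV K N p) :
  dd_spc_cost R Q 0 lambday (g, sigma, u, y) =
  spc_cost R Q lambday (sigma, u, y).
Proof. by rewrite /= mul0r addr0. Qed.

Theorem theorem1 (K : realType) (m p Tini N T : nat)
    (m_gt0 : (0 < m)%N) (p_gt0 : (0 < p)%N) (Tini_gt0 : (0 < Tini)%N)
    (N_gt0 : (0 < N)%N) (T_gt0 : (0 < T)%N) (LT : (Tini + N <= T)%N)
    (ud : blkcV K T m) (yd : blkcV K T p)
    (uini : blkcV K Tini m) (yini : blkcV K Tini p)
    (R : 'M[K]_m) (Q : 'M[K]_p) (lambda1 : K)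
    (U : set 'cV[K]_m) (Y : set 'cV[K]_p) :
  let UP := past_rows (hankel LT ud) in
  let UF := future_rows (hankel LT ud) in
  let YP := past_rows (hankel LT yd) in
  let YF := future_rows (hankel LT yd) in
  posdefmx Q -> posdefmx R -> lambda1 = 0 ->
  convex_set (U : set (convex_lmodType 'cV[K]_m)) ->
  convex_set (Y : set (convex_lmodType 'cV[K]_p)) ->
  (* full row rank, i.e. linearly independent rows *)
  row_free (col_mx UP (col_mx YP UF)) ->
  forall lambday : K, 0 < lambday ->
  forall (u : blkcV K N m) (y : blkcV K N p) (sigma : blkcV K Tini p),
    (exists g : 'cV[K]_(T - (Tini + N)).+1,
       optimal (dd_spc_feasible UP YP UF YF uini yini U Y)
               (dd_spc_cost R Q lambda1 lambday) (g, sigma, u, y)) <->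
    optimal (spc_feasible UP YP UF YF uini yini U Y)
            (spc_cost R Q lambday) (sigma, u, y).
Proof.
move=> UP UF YP YF _ _ -> _ _ fH1 lambday _ u y sigma.
have feaE s v w :=
  dd_spc_feasible_ex _ _ _ _ _ _ UP YP UF YF uini yini U Y s v w fH1.
split=> [[g [fea opt]]|[fea opt]].
(* Each SPC competitor lifts, through some [g'], to a competitor of equal cost in the larger
   problem. *)
- split=> [|[[sigma' u'] y'] /feaE[g' fea']]; first by apply/feaE; exists g.
  by have := opt _ fea'; rewrite !dd_spc_cost0.
(* Any lift [g] is optimal: the cost does not see it, and every competitor projects to an
   SPC-feasible triple of equal cost. *)
- have /feaE[g feag] := fea; exists g.
  split=> // -[[[g' sigma'] u'] y'] fea'.
  by rewrite !dd_spc_cost0; apply: opt; apply/feaE; exists g'.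
Qed.
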